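(* If $T$ is a $3$-peripheral tree and $G$ is a connected graph with $|G|\ge 2$, then $\operatorname{aw}(T\square G,3)=3$.
   Context: All graphs are finite, simple, undirected and connected; $|G|$ denotes the number of vertices of $G$. $\operatorname{d}_G(u,v)$ (or $\operatorname{d}(u,v)$) is the length of a shortest $u$-$v$ path in $G$, and $\operatorname{diam}(G)$ is the maximum distance between pairs of vertices of $G$. A graph $G$ is $n$-peripheral if it contains $n$ (distinct) vertices $u_1,\dots,u_n$ with $\operatorname{d}(u_i,u_j)=\operatorname{diam}(G)$ for all distinct $i,j\in\{1,\dots,n\}$. The Cartesian product $G\square H$ has vertex set $V(G)\times V(H)$, with $(x,y)$ and $(x',y')$ adjacent iff either $x=x'$ and $yy'\in E(H)$, or $y=y'$ and $xx'\in E(G)$. A $k$-term arithmetic progression ($k$-AP) in $G$ is a set of vertices $\{v_1,\dots,v_k\}$ for which there is a $d$ with $\operatorname{d}(v_i,v_{i+1})=d$ for all $1\le i\le k-1$. An exact $r$-coloring of $G$ is a surjective function $c:V(G)\to\{1,\dots,r\}$. A $k$-AP $\{v_1,\dots,v_k\}$ is rainbow under $c$ if $c(v_i)\ne c(v_j)$ whenever $i\neq j$. The anti-van der Waerden number $\operatorname{aw}(G,k)$ is the least positive integer $r$ such that every exact $r$-coloring of $G$ contains a rainbow $k$-AP (if no coloring of the vertices yields a rainbow $k$-AP, then $\operatorname{aw}(G,k)=|V(G)|+1$). *)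

(* Defs.v *)
From mathcomp Require Import all_boot.

Set Implicit Arguments.
Unset Strict Implicit.
Unset Printing Implicit Defensive.

Record sgraph := SGraph {
  vertex :> finType;
  adj : rel vertex;
  adj_sym : symmetric adj;
  adj_irr : irreflexive adj
}.

Section Graph.
Variable G : sgraph.
Implicit Types (x y : G) (c : seq G).

Definition connected := forall x y, connect (@adj G) x y.

(* A repetition-free closed walk of length 1 or 2 is a vertex or an edge, hence
   the bound on the size. *)
Definition acyclic := forall c, ucycle (@adj G) c -> size c < 3.

Definition is_tree := connected /\ acyclic.

Definition has_walk x y n :=
  [exists p : n.-tuple G, path (@adj G) x p && (last x p == y)].

(* Shortest paths have fewer than #|G| edges; the junk value #|G| is returned
   when x and y are not connected. *)
Definition dist x y : nat := find (has_walk x y) (iota 0 #|G|).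

Definition diam : nat := \max_(x : G) \max_(y : G) dist x y.

Definition peripheral n :=
  exists2 u : 'I_n -> G,
    injective u & forall i j, i != j -> dist (u i) (u j) = diam.

Lemma dist_le_card x y : dist x y <= #|G|.
Proof. by rewrite -[leqRHS](size_iota 0) find_size. Qed.

Lemma has_walkP x y n :
  reflect (exists p, [/\ path (@adj G) x p, last x p = y & size p = n])
          (has_walk x y n).
Proof.
apply: (iffP existsP) => [[p /andP[px /eqP pl]]|[p [px pl /eqP sp]]].
  by exists p; rewrite size_tuple.
by exists (Tuple sp); rewrite /= px pl eqxx.
Qed.

Lemma dist_le_walk x p : path (@adj G) x p -> dist x (last x p) <= size p.
Proof.
move=> px; rewrite leqNgt; apply/negP => lt_p.
have lt_card := leq_trans lt_p (dist_le_card _ _).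
have := before_find 0 lt_p; rewrite nth_iota // add0n => /has_walkP; apply.
by exists p.
Qed.

Lemma dist_walk x y :
  connect (@adj G) x y ->
  exists p, [/\ path (@adj G) x p, last x p = y & size p = dist x y].
Proof.
case/connectP => p /shortenP[q qx uq _] ->; apply/has_walkP.
have lt_q : size q < #|G| by rewrite -[_.+1]/(size (x :: q)) -(card_uniqP uq) max_card.
have lt_d : dist x (last x q) < #|G| by exact: leq_ltn_trans (dist_le_walk qx) lt_q.
have hs : has (has_walk x (last x q)) (iota 0 #|G|).
  by rewrite has_find size_iota.
by move: (nth_find 0 hs); rewrite -/(dist _ _) nth_iota // add0n.
Qed.

(* The k-term arithmetic progression {v_1, ..., v_k} is presented by the tuple
   (v_1, ..., v_k). The bound on d only makes the predicate boolean, see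
   [is_APP]. *)
Definition is_AP k (v : k.-tuple G) :=
  [exists d : 'I_#|G|.+1, sorted [rel x y | dist x y == d] v].

Lemma is_APP k (v : k.-tuple G) :
  reflect (exists d, sorted [rel x y | dist x y == d] v) (is_AP v).
Proof.
apply: (iffP existsP) => [[d hd]|[d hd]]; first by exists (val d).
have [le_d|gt_d] := leqP d #|G|; first by exists (Ordinal (le_d : d < #|G|.+1)).
exists ord0; case: v hd => -[//|x [//|y s]] _ /= /andP[/eqP dE _].
by have := dist_le_card x y; rewrite dE leqNgt gt_d.
Qed.

Definition exact_coloring r (c : {ffun G -> 'I_r}) :=
  [forall i : 'I_r, exists x : G, c x == i].

Definition rainbow k r (c : {ffun G -> 'I_r}) (v : k.-tuple G) :=
  uniq (map c v).

Definition forces_rainbow_AP k r :=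
  [forall c : {ffun G -> 'I_r},
    exact_coloring c ==> [exists v : k.-tuple G, is_AP v && rainbow c v]].

(* With more colors than vertices there is no exact coloring at all. *)
Lemma aw_subproof k : exists r, (0 < r) && forces_rainbow_AP k r.
Proof.
exists #|G|.+1; apply/forallP => c; apply/implyP => /forallP c_onto.
have sub : 'I_#|G|.+1 \subset codom c.
  by apply/subsetP => i _; have /existsP[x /eqP <-] := c_onto i; exact: codom_f.
have := leq_trans (subset_leq_card sub) (card_size (codom c)).
by rewrite card_ord size_codom ltnn.
Qed.

(* If no coloring has a rainbow k-AP, this minimum is #|G|.+1, since an exact
   r-coloring exists for every 0 < r <= #|G|. *)
Definition aw k : nat := ex_minn (aw_subproof k).

End Graph.

Section CartesianProduct.
Variables G H : sgraph.

Definition cart_adj : rel (G * H) := fun p q =>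
  (p.1 == q.1) && adj p.2 q.2 || (p.2 == q.2) && adj p.1 q.1.

Lemma cart_adj_sym : symmetric cart_adj.
Proof.
by move=> p q; rewrite /cart_adj ![q.1 == _]eq_sym ![q.2 == _]eq_sym
  (adj_sym q.1) (adj_sym q.2).
Qed.

Lemma cart_adj_irr : irreflexive cart_adj.
Proof. by move=> p; rewrite /cart_adj !adj_irr !andbF. Qed.

Definition cart_prod : sgraph := SGraph cart_adj_sym cart_adj_irr.

End CartesianProduct.

(* Main.v *)
Require Import Defs.
From mathcomp Require Import all_boot zify.

Set Implicit Arguments.
Unset Strict Implicit.
Unset Printing Implicit Defensive.

(** Fewer than three colors cannot give a rainbow 3-AP, so the point is that a
    coloring [c] of [T x G] with three colors, all used, has one. Suppose not.

    Take an edge with two colors and a vertex [w] of the third color. Its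
    distances to the two ends differ by at most one, and they are not equal,
    or [w] would be the middle of a rainbow 3-AP; so some geodesic carries all
    three colors ([exists_rainbow_geodesic]). Choose one, from [x = (t, g)] to
    [y = (t', g')], of minimal length [k]. Minimality spreads the color of its
    inner vertex over the whole grid of vertices between [x] and [y], the two
    ends excepted ([grid_fill]): the grid has one red corner [x], one blue
    corner [y], and is white elsewhere.

    Two 3-APs then move the grid around. If a vertex [v] at distance [k] from
    [y] shares with [x] a white neighbor in the grid, then [v] is red
    ([rainbow_shift]): a geodesic from [t'] to [t] that can be prolonged
    beyond [t] thus gives another such grid, wider in the direction of [T] and
    flatter in that of [G]. If [s] is as far from [t] as [t'] is, then
    [(s, g')] is blue ([rotate]). Hence induct on the distance of [g] and [g'].

    If [g = g'], a shift to a neighboring copy of [T] puts a white vertex at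
    distance [k] from [x], and [x] is then the middle of a rainbow 3-AP
    ([no_horizontal]). If not, and no flatter grid exists, then [t] and [t'] are
    farthest from each other ([farthest]). In a tree with three peripheral
    vertices the four-point condition yields one of them, [s], with
    [d(s, t) = d(s, t') = d(t, t')] ([mutually_farthest_third]). Rotating about
    [x] makes [(s, g')] blue. Rotating about [y] gives a grid with corners [y]
    and [(s, g)], in which [(s, g')] is not a corner and so is white: a
    contradiction ([no_grid]). *)

(** * Distances in a connected graph *)

Section Metric.
Variable G : sgraph.
Hypothesis conG : connected G.
Implicit Types x y z w : G.

Lemma distxx x : dist x x = 0.
Proof. by apply/eqP; rewrite -leqn0; exact: (@dist_le_walk _ x [::]). Qed.

Lemma dist_eq0 x y : dist x y = 0 -> x = y.
Proof.
by have [p [_ <- <-]] := dist_walk (conG x y); case: p.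
Qed.

Lemma dist_gt0 x y : x <> y -> 0 < dist x y.
Proof. by rewrite lt0n => ne; apply/eqP => /dist_eq0. Qed.

Lemma dist_triangle x y z : dist x z <= dist x y + dist y z.
Proof.
have [p [px py <-]] := dist_walk (conG x y).
have [q [qy qz <-]] := dist_walk (conG y z).
rewrite -size_cat -qz -py -last_cat; apply: dist_le_walk.
by rewrite cat_path px py.
Qed.

Lemma dist_adj x y : adj x y -> dist x y <= 1.
Proof. by move=> xy; apply: (@dist_le_walk _ x [:: y]); rewrite /= xy. Qed.

Lemma dist_step x y : x <> y ->
  exists x', adj x x' /\ (dist x' y).+1 = dist x y.
Proof.
have [[|x' p] [/= xp pE sp]] := dist_walk (conG x y); first by rewrite pE.
case/andP: xp => xx' px' _; exists x'; split=> //; rewrite -pE in sp *.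
have := dist_le_walk px'; have := dist_triangle x x' (last x' p).
by have := dist_adj xx'; lia.
Qed.

Lemma dist_sym x y : dist x y = dist y x.
Proof.
suff le (a b : G) : dist a b <= dist b a by apply/eqP; rewrite eqn_leq !le.
move dba: (dist b a) => n; elim: n b dba => [|n IH] b dba.
  by rewrite (dist_eq0 dba) distxx.
have [|b' [bb' db']] := @dist_step b a.
  by move=> ba; move: dba; rewrite ba distxx.
rewrite dba in db'; have := IH b' (succn_inj db').
have := dist_triangle a b' b; rewrite adj_sym in bb'.
by have := dist_adj bb'; lia.
Qed.

Lemma between_sym x y z :
  dist x z + dist z y = dist x y -> dist y z + dist z x = dist y x.
Proof. by rewrite addnC (dist_sym y z) (dist_sym z x) (dist_sym y x). Qed.

Lemma dist_adj1 x y : adj x y -> dist x y = 1.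
Proof.
move=> xy; have := dist_adj xy; case d0: (dist x y) => [|[|]] // _.
by move: xy; rewrite (dist_eq0 d0) adj_irr.
Qed.

Lemma geodesic_edge x y n : n < dist x y ->
  exists s s', [/\ adj s s', dist x s = n & dist x s' = n.+1].
Proof.
move dxy: (dist x y) => m; elim: m y dxy => // m IH y dxy lt_n.
have [|y' [yy' dy']] := @dist_step y x.
  by move=> yx; move: dxy; rewrite yx distxx.
rewrite (dist_sym y') (dist_sym y) dxy in dy'; case: dy' => dy'.
have [lt_nm|le_mn] := ltnP n m; first exact: IH dy' lt_nm.
exists y', y; rewrite adj_sym yy'; split=> //; lia.
Qed.

(** The form in which [z] not lying between [x] and [y] is used: a geodesic
    misses [z], so deleting any edge at [z] leaves [x] and [y] connected. *)
Lemma geodesic_avoiding x y z : dist x z + dist z y <> dist x y ->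
  connect [rel u v | [&& adj u v, u != z & v != z]] x y.
Proof.
have [p [px py sp]] := dist_walk (conG x y) => nz.
apply/connectP; exists p => //.
have zNp : z \notin x :: p.
  apply/negP; rewrite inE => /predU1P[zx|zp].
    by case: nz; rewrite zx distxx.
  case/splitPr: zp px py sp nz => p1 p2.
  rewrite -cat_rcons cat_path last_cat last_rcons size_cat.
  case/andP=> px1 px2 yE sp nz; have := dist_triangle x z y.
  have := dist_le_walk px1; have := dist_le_walk px2.
  by rewrite last_rcons yE; lia.
apply: (@sub_in_path _ (predC1 z)) px => [u v uz vz /= ->|].
  by rewrite -!topredE /= in uz vz; rewrite uz vz.
by apply/allP => u up /=; apply: contraNneq zNp => <-.
Qed.

End Metric.

(** * Trees and the four-point condition *)

Section Tree.
Variable T : sgraph.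
Hypothesis treeT : is_tree T.
Implicit Types x y z w : T.

Let conT : connected T := treeT.1.

(** Another path between the ends of an edge would close up to a cycle. *)
Lemma tree_bridge x x' : adj x x' ->
  ~~ connect [rel u v | adj u v && ~~ [|| (u == x) && (v == x')
                                        | (u == x') && (v == x)]] x x'.
Proof.
move=> xx'; apply/negP => /connectP[p0 /shortenP[p px up _] x'E].
have := treeT.2 (x :: p); rewrite /ucycle up andbT /= rcons_path -x'E.
rewrite adj_sym xx' andbT => lt3.
have {lt3} := lt3 (sub_path (fun u v uv => proj1 (andP uv)) px).
case: p px {up} x'E => [|y [|//]] /= px x'E _.
  by rewrite x'E adj_irr in xx'.
by rewrite x'E !eqxx /= andbF in px.
Qed.

(** The edge [xx'] separates [x] from [y]. If both alternatives failed, the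
    geodesics from [x] to [w], from [w] to [y] and from [y] to [x'] would lead
    from [x] to [x'] without that edge. *)
Lemma tree_step x x' y w : adj x x' -> (dist x' y).+1 = dist x y ->
  dist x x' + dist x' w = dist x w \/ dist w x + dist x y = dist w y.
Proof.
move=> xx' x'y.
have [|/eqP x'w] := eqVneq (dist x x' + dist x' w) (dist x w); first by left.
have [|/eqP xw] := eqVneq (dist w x + dist x y) (dist w y); first by right.
have xy : dist y x + dist x x' <> dist y x'.
  by rewrite (dist_sym conT y) (dist_sym conT y x'); lia.
case/negP: (tree_bridge xx').
have sub z u v : z \in [:: x; x'] ->
    connect [rel a b | [&& adj a b, a != z & b != z]] u v ->
  connect [rel a b | adj a b && ~~ [|| (a == x) && (b == x')
                                     | (a == x') && (b == x)]] u v.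
  rewrite !inE => zE; apply: connect_sub => a b /and3P[ab az bz].
  apply: connect1; rewrite /= ab.
  by case/pred2P: zE az bz => -> /negPf-> /negPf->; rewrite ?andbF.
apply: (connect_trans (sub x' _ _ _ (geodesic_avoiding conT x'w))).
  by rewrite !inE eqxx orbT.
apply: (connect_trans (sub x _ _ _ (geodesic_avoiding conT xw))).
  by rewrite !inE eqxx.
apply: (sub x _ _ _ (geodesic_avoiding conT xy)).
by rewrite !inE eqxx.
Qed.

(** Move [x] one step towards [y]. If this step also leads towards [z] and [w],
    every sum drops by one; otherwise [tree_step] puts [x] between [y] and one
    of [z] and [w], and the triangle inequality at [x] suffices. *)
Lemma tree_four_point x y z w :
  dist x y + dist z w <= maxn (dist x z + dist y w) (dist x w + dist y z).
Proof.
move dxy: (dist x y) => n; elim: n x dxy => [|n IH] x dxy.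
  rewrite (dist_eq0 conT dxy) -(dist_sym conT z).
  by have := dist_triangle conT z y w; lia.
have [|x' [xx' x'y]] := @dist_step _ conT x y.
  by move=> xy; move: dxy; rewrite xy distxx.
have := IH x'; rewrite dxy in x'y; move/(_ (succn_inj x'y)).
have := dist_triangle conT z x w; rewrite -dxy in x'y.
have := tree_step z xx' x'y; have := tree_step w xx' x'y.
rewrite (dist_adj1 conT xx') !(dist_sym conT w) !(dist_sym conT z).
rewrite (dist_sym conT w z); lia.
Qed.

(** Apply the four-point condition to [t], [t'] and two of the peripheral
    vertices, [ui] and [uj]. The sum [dist t t' + diam] is at most one of the
    other two sums, and these are at most [2 * dist t t'] by assumption. So
    [dist t t' = diam], one of them attains [2 * dist t t'], and of any two
    peripheral vertices one is at that distance from [t] and the other from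
    [t']. Hence at most one of the three is closer to [t], at most one to [t'],
    and a third remains. *)
Lemma mutually_farthest_third t t' : peripheral T 3 ->
  (forall w, dist t w <= dist t t') -> (forall w, dist t' w <= dist t t') ->
  exists s, dist t s = dist t t' /\ dist t' s = dist t t'.
Proof.
case=> u _ du far far'.
have le_diam : dist t t' <= diam T.
  by apply: leq_trans (leq_bigmax t); apply: (leq_bigmax t').
have pair i j : i != j ->
    (dist t (u i) = dist t t' /\ dist t' (u j) = dist t t') \/
    (dist t (u j) = dist t t' /\ dist t' (u i) = dist t t').
  move=> ij; have := tree_four_point t t' (u i) (u j); rewrite (du _ _ ij).
  move: (far (u i)) (far (u j)) (far' (u i)) (far' (u j)); lia.
pose u0 := u ord0; pose u1 := u (inord 1); pose u2 := u (inord 2).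
have p01 := pair ord0 (inord 1); have p02 := pair ord0 (inord 2).
have p12 := pair (inord 1) (inord 2).
rewrite -!val_eqE /= !inordK // in p01 p02 p12.
move: (p01 isT) (p02 isT) (p12 isT) => {p01 p02 p12 pair}.
rewrite -/u0 -/u1 -/u2.
(* A sum attains 2 * dist t t' only if both of its terms are maximal. *)
have [?|?] := eqVneq (dist t u0 + dist t' u0) (dist t t' + dist t t').
  by exists u0; move: (far u0) (far' u0); lia.
have [?|?] := eqVneq (dist t u1 + dist t' u1) (dist t t' + dist t t').
  by exists u1; move: (far u1) (far' u1); lia.
by exists u2; lia.
Qed.

End Tree.

(** * The distance in a Cartesian product *)

Section ProductDistance.
Variables G H : sgraph.
Hypotheses (conG : connected G) (conH : connected H).
Local Notation X := (cart_prod G H).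

Lemma cart_walk_le (x : X) p : path (@adj X) x p ->
  dist x.1 (last x p).1 + dist x.2 (last x p).2 <= size p.
Proof.
elim: p x => [|y p IH] x /=; first by rewrite !distxx.
have := dist_triangle conG x.1 y.1 (last y p).1.
have := dist_triangle conH x.2 y.2 (last y p).2.
move=> tri2 tri1 /andP[xy /IH{}IH].
by case/orP: xy tri1 tri2 IH => /andP[/eqP-> /dist_adj] /=; rewrite distxx; lia.
Qed.

Lemma cart_walk (x y : X) : exists p,
  [/\ path (@adj X) x p, last x p = y & size p = dist x.1 y.1 + dist x.2 y.2].
Proof.
have [p [px py sp]] := dist_walk (conG x.1 y.1).
have [q [qx qy sq]] := dist_walk (conH x.2 y.2).
exists (map (fun a => (a, x.2)) p ++ map (fun b => (y.1, b)) q).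
rewrite size_cat !size_map sp sq.
have lastp : last x (map (fun a => (a, x.2)) p) = (y.1, x.2).
  by rewrite -py {1}[x]surjective_pairing last_map.
rewrite cat_path last_cat lastp last_map qy -surjective_pairing.
split=> //; apply/andP; split.
  rewrite {1}[x]surjective_pairing path_map; apply: sub_path px => a b ab.
  by rewrite /= /cart_adj /= eqxx ab orbT.
rewrite path_map; apply: sub_path qx => a b ab.
by rewrite /= /cart_adj /= eqxx ab.
Qed.

Lemma cart_connected : connected X.
Proof.
by move=> x y; have [p [px <- _]] := cart_walk x y; apply/connectP; exists p.
Qed.

Lemma cart_dist (x y : X) : dist x y = dist x.1 y.1 + dist x.2 y.2.
Proof.
apply/eqP; rewrite eqn_leq; apply/andP; split.
  by have [p [px <- <-]] := cart_walk x y; apply: dist_le_walk px.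
have [p [px <- <-]] := dist_walk (cart_connected x y).
exact: cart_walk_le.
Qed.

End ProductDistance.

(** * Rainbow-free colorings with three colors *)

Lemma ord3_eq (i j k l : 'I_3) :
  i != j -> j != k -> i != k -> l != i -> l != j -> l = k.
Proof.
rewrite -!val_eqE /= => *; apply: val_inj => /=.
have := ltn_ord i; have := ltn_ord j; have := ltn_ord k; have := ltn_ord l; lia.
Qed.

Lemma ord3_third (i j : 'I_3) : exists2 k, i != k & j != k.
Proof.
have /set0Pn[k] : ~: [set i; j] != set0.
  by rewrite -card_gt0; have := cardsC [set i; j]; rewrite card_ord cards2; lia.
by rewrite !inE negb_or ![k == _]eq_sym => /andP[? ?]; exists k.
Qed.

Section Coloring.
Variable G : sgraph.
Implicit Types x y z w v : G.

Definition rainbow_free (c : G -> 'I_3) := forall x y z,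
  dist x y = dist y z -> c x != c y -> c y != c z -> c x = c z.

Variable c : G -> 'I_3.

(** A geodesic with all three colors, of which only the ends and one inner
    vertex matter. *)
Record rainbow_geodesic x z y : Prop := RainbowGeodesic {
  rg_between : dist x z + dist z y = dist x y;
  rg_xz : c x != c z;
  rg_zy : c z != c y;
  rg_xy : c x != c y
}.

Hypothesis conG : connected G.
Hypothesis cfree : rainbow_free c.

Lemma rainbow_geodesic_sym x z y :
  rainbow_geodesic x z y -> rainbow_geodesic y z x.
Proof.
case=> xzy xz zy xy; split; rewrite 1?eq_sym //.
exact: between_sym.
Qed.

Lemma rainbow_geodesic_neq x z y : rainbow_geodesic x z y -> x <> z /\ z <> y.
Proof. by case=> _ xz zy _; split=> e; move: xz zy; rewrite e eqxx. Qed.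

Lemma rainbow_geodesic_color x z z' y :
  rainbow_geodesic x z y -> rainbow_geodesic x z' y -> c z = c z'.
Proof.
case=> _ xz zy xy [_ xz' zy' _].
by apply: (@ord3_eq (c x) (c y) (c z') (c z)); rewrite // eq_sym.
Qed.

(** Take an edge [xy] with two colors and a vertex [w] of the third. The
    distances from [w] to [x] and [y] differ, or [x, w, y] would be a rainbow
    3-AP, hence they differ by one and the edge prolongs a geodesic from [w]. *)
Lemma exists_rainbow_geodesic :
  (forall i, exists x, c x = i) -> exists x z y, rainbow_geodesic x z y.
Proof.
move=> csurj.
have [x [y [xy cxy]]] : exists x y, adj x y /\ c x != c y.
  have [x0 cx0] := csurj ord0; have [y0 cy0] := csurj ord_max.
  have [p [px py _]] := dist_walk (conG x0 y0).
  have : c x0 != c (last x0 p) by rewrite py cx0 cy0.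
  elim: p x0 px {cx0 py} => [|x1 p IH] x0 /=; first by rewrite eqxx.
  case/andP=> x01 /IH{}IH; have [->//|ne] := eqVneq (c x0) (c x1).
  by exists x0, x1.
have [i xi yi] := ord3_third (c x) (c y); have [w cw] := csurj i.
rewrite -{i}cw in xi yi.
have [xwy|xwy] := eqVneq (dist x w) (dist w y).
  by case/eqP: cxy; apply: (cfree xwy); rewrite // eq_sym.
have := dist_triangle conG x y w; have := dist_triangle conG y x w.
rewrite (dist_sym conG w) in xwy; have := dist_adj1 conG xy.
rewrite (dist_sym conG y x) => xy1 le1 le2.
have [lt|gt|eq] := ltngtP (dist x w) (dist y w).
- by exists w, x, y; split; rewrite // 1?eq_sym // !(dist_sym conG w); lia.
- exists w, y, x; split; rewrite // 1?eq_sym // !(dist_sym conG w).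
  by rewrite (dist_sym conG y x); lia.
by rewrite eq eqxx in xwy.
Qed.

(** [v] has the color of [x]: the 3-AP [v, y, x] excludes the color of [z], and
    [v, z, x] that of [y]. *)
Lemma rainbow_shift x z y v : rainbow_geodesic x z y ->
  adj x z -> adj z v -> dist v y = dist x y -> rainbow_geodesic v z y.
Proof.
case=> xzy xz zy xy axz azv vy.
have cvx : c v = c x.
  apply/eqP; apply/negPn/negP => /eqP cvx; case/eqP: zy.
  have <- : c v = c z.
    apply/eqP/negPn/negP => vz; apply: cvx; apply: (@cfree v z x) => //.
      by rewrite !(dist_sym conG _ z) !dist_adj1 // adj_sym.
    by rewrite eq_sym.
  apply/eqP/negPn/negP => cvy; apply: cvx; apply: (@cfree v y x) => //.
    by rewrite vy (dist_sym conG).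
  by rewrite eq_sym.
split; rewrite ?cvx // (dist_sym conG v) vy -xzy.
by rewrite (dist_adj1 conG axz) (dist_adj1 conG azv).
Qed.

Section Minimal.
Variable k : nat.
Hypothesis kmin : forall x z y, rainbow_geodesic x z y -> k <= dist x y.

(** If [z'] had the color of [x], then [z', z, y] would be shorter; if it had
    the color of [y], then [x, z', z] would be. *)
Lemma rainbow_fill x z y z' : rainbow_geodesic x z y -> dist x y = k ->
  dist x z' + dist z' z = dist x z -> z' <> x -> rainbow_geodesic x z' y.
Proof.
move=> tri dk xz'z z'x; have [xz zy] := rainbow_geodesic_neq tri.
case: tri => xzy cxz czy cxy.
have z'y : dist z' z + dist z y = dist z' y.
  have := dist_triangle conG x z' y; have := dist_triangle conG z' z y; lia.
have xz' : 0 < dist x z' by apply: dist_gt0 => // e; case: z'x.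
have {}zy := dist_gt0 conG zy.
split=> //; first lia.
  apply/eqP => e; suff /kmin : rainbow_geodesic z' z y by lia.
  by split; rewrite -?e.
apply/eqP => e; suff /kmin : rainbow_geodesic x z' z by lia.
by split; rewrite ?e // eq_sym.
Qed.

End Minimal.
End Coloring.

(** * Shortest rainbow geodesics in a product *)

Section ProductColoring.
Variables T G : sgraph.
Hypotheses (conT : connected T) (conG : connected G).
Implicit Types (t s p q : T) (g h : G).

(** The pair as a vertex of the product graph, so that its distances are
    recognized as distances of that graph. *)
Definition pt t g : cart_prod T G := (t, g).

Lemma pt_dist t g t' g' : dist (pt t g) (pt t' g') = dist t t' + dist g g'.
Proof. by rewrite cart_dist. Qed.

Lemma pt_adjl t t' g : adj t t' -> adj (pt t g) (pt t' g).
Proof. by move=> tt'; rewrite /= /cart_adj /= eqxx tt' orbT. Qed.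

Lemma pt_adjr t g g' : adj g g' -> adj (pt t g) (pt t g').
Proof. by move=> gg'; rewrite /= /cart_adj /= eqxx gg'. Qed.

Variable c : cart_prod T G -> 'I_3.
Hypothesis cfree : rainbow_free c.

Let conX : connected (cart_prod T G) := cart_connected conT conG.
Local Notation rg := (rainbow_geodesic c).

Lemma pt_between t g p h t' g' : rg (pt t g) (pt p h) (pt t' g') ->
  dist t p + dist p t' = dist t t' /\ dist g h + dist h g' = dist g g'.
Proof.
case; rewrite !pt_dist => + _ _ _.
by have := dist_triangle conT t p t'; have := dist_triangle conG g h g'; lia.
Qed.

Variable k : nat.
Hypothesis kmin : forall x z y, rg x z y -> k <= dist x y.

Lemma fill_left t g p h t' g' q i :
  rg (pt t g) (pt p h) (pt t' g') -> dist t t' + dist g g' = k ->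
  dist t q + dist q p = dist t p -> dist g i + dist i h = dist g h ->
  q <> t \/ i <> g -> rg (pt t g) (pt q i) (pt t' g').
Proof.
move=> tri dk tqp gih ne; apply: (rainbow_fill conX kmin tri).
- by rewrite pt_dist.
- by rewrite !pt_dist; lia.
by case=> qt ig; case: ne.
Qed.

Lemma fill_right t g p h t' g' q i :
  rg (pt t g) (pt p h) (pt t' g') -> dist t t' + dist g g' = k ->
  dist p q + dist q t' = dist p t' -> dist h i + dist i g' = dist h g' ->
  q <> t' \/ i <> g' -> rg (pt t g) (pt q i) (pt t' g').
Proof.
move=> /(rainbow_geodesic_sym conX) tri dk pqt' hig' ne.
apply/(rainbow_geodesic_sym conX)/(fill_left tri) => //.
- by rewrite (dist_sym conT) (dist_sym conG).
- exact: between_sym.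
exact: between_sym.
Qed.

(** From the corner [(t, g')] the color spreads along two sides of the grid and
    from these to all of it but the opposite corner [(t', g)]. That corner is
    reached from a neighbor on one of its own sides, one of which has length
    at least two: in a 2 x 2 grid the first corner would be the middle of a
    rainbow 3-AP. *)
Lemma grid_fill_corner t g t' g' p h :
  rg (pt t g) (pt t g') (pt t' g') -> dist t t' + dist g g' = k ->
  t <> t' -> g <> g' ->
  dist t p + dist p t' = dist t t' -> dist g h + dist h g' = dist g g' ->
  p <> t \/ h <> g -> p <> t' \/ h <> g' -> rg (pt t g) (pt p h) (pt t' g').
Proof.
move=> tri dk tt' gg' tpt' ghg' nx ny.
have dtt' := dist_gt0 conT tt'; have dgg' := dist_gt0 conG gg'.
have top q : dist t q + dist q t' = dist t t' -> q <> t' ->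
    rg (pt t g) (pt q g') (pt t' g').
  by move=> tqt' qt'; apply: (fill_right tri dk tqt'); [rewrite distxx|left].
have side i : dist g i + dist i g' = dist g g' -> i <> g ->
    rg (pt t g) (pt t i) (pt t' g').
  by move=> gig' ig; apply: (fill_left tri dk _ gig'); [rewrite distxx|right].
have upper q i : dist t q + dist q t' = dist t t' ->
    dist g i + dist i g' = dist g g' -> i <> g -> q <> t' \/ i <> g' ->
    rg (pt t g) (pt q i) (pt t' g').
  move=> tqt' gig' ig; apply: (fill_right (side _ gig' ig) dk tqt').
  by rewrite distxx.
have bottom q : dist t q + dist q t' = dist t t' -> q <> t' -> q <> t ->
    rg (pt t g) (pt q g) (pt t' g').
  move=> tqt' qt' qt; apply: (fill_left (top _ tqt' qt') dk); last by left.
    by rewrite distxx addn0.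
  by rewrite distxx.
have [hg|/eqP hg] := eqVneq h g; last exact: upper.
subst h; have [pt'|/eqP pt'] := eqVneq p t'; last first.
  by apply: bottom => //; case: nx.
subst p; have [dt|dt] := ltnP 1 (dist t t').
  have [s [t's st]] := dist_step conT (not_eq_sym tt').
  have dt's := dist_adj1 conT t's.
  have dst := dist_sym conT s t'; rewrite (dist_sym conT t') in st.
  rewrite (dist_sym conT s t) in st.
  apply: (@fill_right _ _ s g _ _ _ _ _ dk); rewrite ?distxx ?addn0 //.
    apply: bottom => [|e|e]; first by lia.
      by rewrite e distxx in dst dt's; lia.
    by rewrite e distxx in st; lia.
have [dg|dg] := ltnP 1 (dist g g').
  have [i [gi ig']] := dist_step conG gg'.
  have dgi := dist_adj1 conG gi.
  apply: (@fill_left _ _ t' i _ _ _ _ _ dk); rewrite ?distxx ?addn0 //.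
    have ig : i <> g by move=> e; rewrite e distxx in dgi.
    have ig'ne : i <> g' by move=> e; move: ig' dg; rewrite e distxx => <-.
    by apply: upper => //; [lia|right].
case: (tri) => _ xz zy /eqP[]; apply: (cfree _ xz zy).
by rewrite !pt_dist !distxx; lia.
Qed.

(** Wherever [z] lies in the grid, [rainbow_fill] carries its color to one of
    the two free corners. *)
Lemma grid_fill t g z t' g' p h :
  rg (pt t g) z (pt t' g') -> dist t t' + dist g g' = k ->
  t <> t' -> g <> g' ->
  dist t p + dist p t' = dist t t' -> dist g h + dist h g' = dist g g' ->
  p <> t \/ h <> g -> p <> t' \/ h <> g' -> rg (pt t g) (pt p h) (pt t' g').
Proof.
case: z => q i tri dk tt' gg' tpt' ghg' nx ny.
have [tqt' gig'] := pt_between tri.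
have [qt'|/eqP qt'] := eqVneq q t'.
  have corner : rg (pt t g) (pt t' g) (pt t' g').
    rewrite qt' in tri; apply: (fill_left tri dk); rewrite ?distxx ?addn0 //.
    by left; exact: not_eq_sym.
  apply/(rainbow_geodesic_sym conX)/grid_fill_corner => //.
  - exact: rainbow_geodesic_sym.
  - by rewrite (dist_sym conT) (dist_sym conG).
  - exact: not_eq_sym.
  - exact: not_eq_sym.
  - exact: between_sym.
  exact: between_sym.
apply: grid_fill_corner => //.
have tri' : rg (pt t g) (pt q g') (pt t' g').
  by apply: (fill_right tri dk); rewrite ?distxx ?addn0 //; left.
apply: (fill_left tri' dk); rewrite ?distxx ?addn0 //.
by right; exact: not_eq_sym.
Qed.

(** With [t1] next to [t] on the geodesic, the shift of [(t, g)] is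
    [(t1, h)]. The grid from there to [(t', g)] contains [(s, h)], where [s]
    precedes [t'], and [(s, h)] is as far from [(t, g)] as [(t', g)] is. *)
Lemma no_horizontal t g z t' h : adj g h ->
  rg (pt t g) z (pt t' g) -> dist t t' = k -> False.
Proof.
case: z => z1 z2 gh tri dk.
have [tzt' gzg] := pt_between tri; rewrite distxx in gzg.
have dk' : dist t t' + dist g g = k by rewrite distxx addn0.
have gz2 : g = z2 by apply: (dist_eq0 conG); lia.
subst z2.
have [xz zy] := rainbow_geodesic_neq tri.
have tz : t <> z1 by move=> e; apply: xz; rewrite e.
have [t1 [tt1 t1z]] := dist_step conT tz.
have dtt1 := dist_adj1 conT tt1; have dgh := dist_adj1 conG gh.
have triw : rg (pt t g) (pt t1 g) (pt t' g).
  apply: (fill_left tri dk'); rewrite ?distxx //; first by lia.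
  by left=> e; rewrite e distxx in dtt1.
have [tt1t' _] := pt_between triw.
have [_ wy] := rainbow_geodesic_neq triw.
have t1t' : t1 <> t' by move=> e; apply: wy; rewrite e.
(* A rainbow geodesic with two edges would itself be a rainbow 3-AP. *)
have t1t'2 : dist t1 t' != 1.
  apply/eqP => d1; case: triw => _ xw /(cfree _ xw) e /eqP[]; apply: e.
  by rewrite !pt_dist distxx dtt1 d1.
have dv : dist t1 t' + dist h g = k by rewrite (dist_sym conG h); lia.
have triv : rg (pt t1 h) (pt t1 g) (pt t' g).
  apply: (rainbow_shift conX cfree triw).
  - exact: pt_adjl.
  - exact: pt_adjr.
  by rewrite !pt_dist dv.
have [s [t's st1]] := dist_step conT (not_eq_sym t1t').
have dst' := dist_adj1 conT t's.
rewrite (dist_sym conT s) (dist_sym conT t') in st1.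
rewrite (dist_sym conT t' s) in dst'.
have trip : rg (pt t1 h) (pt s h) (pt t' g).
  apply: (grid_fill triv dv) => //; rewrite ?distxx //.
  - by move=> e; rewrite e distxx in dgh.
  - lia.
  - by left=> e; move: st1 t1t'2; rewrite e distxx => <-.
  - by left=> e; rewrite e distxx in dst'.
have ctt := rainbow_geodesic_color triv trip.
have dst : dist (pt s h) (pt t g) = dist (pt t g) (pt t' g).
  have := dist_triangle conT t t1 s; have := dist_triangle conT t s t'.
  rewrite !pt_dist (dist_sym conG h) dk' (dist_sym conT s t); lia.
case: triw ctt => _ xw _ xy ctt; case: trip => _ _ /eqP py _; apply: py.
by apply: (cfree dst _ xy); rewrite -ctt eq_sym.
Qed.

Section Extension.
Variable b : nat.
Hypothesis no_flatter : forall t g z t' g',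
  rg (pt t g) z (pt t' g') -> dist t t' + dist g g' = k -> dist g g' <> b.

(** A shift of [(t, g)] along [ts] and one step towards [g'] would give a
    flatter grid. *)
Lemma not_extendable t g z t' g' s :
  rg (pt t g) z (pt t' g') -> dist t t' + dist g g' = k -> dist g g' = b.+1 ->
  adj t s -> dist s t' <> (dist t t').+1.
Proof.
move=> tri dk dg ts dst'.
have gg' : g <> g' by move=> e; rewrite e distxx in dg.
have [g1 [gg1 dg1 triw]] : exists g1, [/\ adj g g1, dist g1 g' = b
    & rg (pt t g) (pt t g1) (pt t' g')].
  have [tt'|/eqP tt'] := eqVneq t t'; last first.
    have [g1 [gg1 dg1]] := dist_step conG gg'; exists g1; split=> //.
      by rewrite dg in dg1; case: dg1.
    have dgg1 := dist_adj1 conG gg1.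
    apply: (grid_fill tri dk) => //; rewrite ?distxx //; first by lia.
      by right=> e; rewrite e distxx in dgg1.
    by left.
  (* When t = t', the grid is an interval of G, through which color need not
     spread: a first vertex on the way to the given inner one is taken. *)
  subst t'; case: z tri => z1 z2 tri.
  have [tzt gzg'] := pt_between tri; rewrite distxx in tzt.
  have tz : t = z1 by apply: (dist_eq0 conT); lia.
  subst z1; have [xz _] := rainbow_geodesic_neq tri.
  have gz : g <> z2 by move=> e; apply: xz; rewrite e.
  have [g1 [gg1 dg1]] := dist_step conG gz; exists g1.
  have dgg1 := dist_adj1 conG gg1; split=> //.
    have := dist_triangle conG g g1 g'; have := dist_triangle conG g1 z2 g'.
    by lia.
  apply: (fill_left tri dk); rewrite ?distxx //; first by lia.
  by right=> e; rewrite e distxx in dgg1.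
have dv : dist s t' + dist g1 g' = k by lia.
apply: (no_flatter (rainbow_shift conX cfree triw _ _ _) dv dg1).
- exact: pt_adjr.
- exact: pt_adjl.
by rewrite !pt_dist dv dk.
Qed.

(** [(s, g')] does not have the color of the corner [(t, g')], as its 3-AP with
    [(t, g)] and [(t', g')] shows, nor that of [(t, g)], as its 3-AP with that
    corner and [(t', g')] shows. *)
Lemma rotate t g z t' g' s :
  rg (pt t g) z (pt t' g') -> dist t t' + dist g g' = k ->
  t <> t' -> g <> g' -> dist t s = dist t t' ->
  rg (pt t g) (pt t g') (pt s g').
Proof.
move=> tri dk tt' gg' dts.
have [_ xq qy xy] : rg (pt t g) (pt t g') (pt t' g').
  apply: (grid_fill tri dk); rewrite ?distxx ?addn0 //; last by left.
  by right; exact: not_eq_sym.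
have sx : dist (pt s g') (pt t g) = dist (pt t g) (pt t' g').
  by rewrite !pt_dist (dist_sym conT s) (dist_sym conG g') dts.
have sq : dist (pt s g') (pt t g') = dist (pt t g') (pt t' g').
  by rewrite !pt_dist (dist_sym conT s) dts.
split=> //; first by rewrite !pt_dist !distxx; lia.
  apply/eqP => e; case/eqP: qy; rewrite e; apply: (cfree sx) => //.
  by rewrite -e eq_sym.
apply/eqP => e; case/eqP: xy; rewrite e; apply: (cfree sq) => //.
by rewrite -e.
Qed.

(** A geodesic from [t] longer than [dist t t'] passes at that distance through
    some [s]; rotated to [(s, g')], the grid could be extended beyond [s]. *)
Lemma farthest t g z t' g' :
  rg (pt t g) z (pt t' g') -> dist t t' + dist g g' = k -> dist g g' = b.+1 ->
  t <> t' -> forall w, dist t w <= dist t t'.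
Proof.
move=> tri dk dg tt' w; rewrite leqNgt; apply/negP.
case/(geodesic_edge conT) => s [s' [ss' ts ts']].
have gg' : g <> g' by move=> e; rewrite e distxx in dg.
have tri' := rotate tri dk tt' gg' ts.
apply: (not_extendable (rainbow_geodesic_sym conX tri') _ _ ss').
- by rewrite (dist_sym conT s) (dist_sym conG g') ts.
- by rewrite (dist_sym conG).
by rewrite !(dist_sym conT _ t) ts' ts.
Qed.

(** If [t = t'], any neighbor of [t] extends the grid. Otherwise [s] as in
    [mutually_farthest_third] gives [(s, g')] the color of [(t', g')], by a
    3-AP through [(t, g)], and the color of the inner vertices, as part of the
    grid rotated about [(t', g')]. *)
Lemma no_grid t g z t' g' : is_tree T -> peripheral T 3 ->
  rg (pt t g) z (pt t' g') -> dist t t' + dist g g' = k -> dist g g' <> b.+1.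
Proof.
move=> treeT perT tri dk dg.
have gg' : g <> g' by move=> e; rewrite e distxx in dg.
have tt' : t <> t'.
  move=> tt'; subst t'.
  have [s ts] : exists s, t <> s.
    case: perT => u uinj _; have [e|/eqP ne] := eqVneq t (u ord0).
      by exists (u ord_max); rewrite e => /uinj.
    by exists (u ord0).
  have [s' [ts' _]] := dist_step conT ts.
  apply: (not_extendable tri dk dg ts').
  by rewrite distxx (dist_sym conT) (dist_adj1 conT ts').
have tri' := rainbow_geodesic_sym conX tri.
have dk' : dist t' t + dist g' g = k.
  by rewrite (dist_sym conT) (dist_sym conG).
have t't := not_eq_sym tt'; have g'g := not_eq_sym gg'.
have [||s [ts t's]] := @mutually_farthest_third _ treeT t t' perT.
- exact: farthest tri dk dg tt'.
- rewrite (dist_sym conT t); apply: farthest tri' dk' _ t't.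
  by rewrite (dist_sym conG).
have [_ _ _ xs] := rotate tri dk tt' gg' ts.
have trisg : rg (pt t' g') (pt t' g) (pt s g).
  by apply: rotate tri' dk' t't g'g _; rewrite t's (dist_sym conT).
have t's_neq : t' <> s.
  by move=> e; apply/tt'/(dist_eq0 conT); rewrite -t's e distxx.
have dsk : dist t' s + dist g' g = k by rewrite t's (dist_sym conG).
have [_ /eqP ys _ _] : rg (pt t' g') (pt s g') (pt s g).
  apply: (grid_fill trisg dsk) => //; rewrite ?distxx ?addn0 //.
    by left; exact: not_eq_sym.
  by right.
case: tri => _ _ _ xy; apply: ys; apply/esym; apply: (cfree _ _ xy).
  by rewrite !pt_dist (dist_sym conT s) (dist_sym conG g') ts.
by rewrite eq_sym.
Qed.

End Extension.

End ProductColoring.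

(** * The anti-van der Waerden number *)

Lemma no_rainbow_geodesic (T G : sgraph) (c : cart_prod T G -> 'I_3) x z y :
  is_tree T -> peripheral T 3 -> connected G -> 2 <= #|G| ->
  rainbow_free c -> ~ rainbow_geodesic c x z y.
Proof.
move=> treeT perT conG G2 cfree tri.
have conT := treeT.1.
(* Unbounded lower bounds: in the step k is a lower bound on the length of
   rainbow geodesics, and none has length exactly k. *)
suff bound n x' z' y' : rainbow_geodesic c x' z' y' -> n <= dist x' y'.
  by have := bound (dist x y).+1 _ _ _ tri; rewrite ltnn.
elim: n x' z' y' => // k kmin [t g] z' [t' g'] tri'.
have:= kmin _ _ _ tri'; rewrite leq_eqVlt => /predU1P[dk|//]; exfalso.
rewrite (pt_dist conT conG) in dk.
have [b] : exists b, dist g g' = b by exists (dist g g').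
elim: b t g z' t' g' tri' dk => [|b IH] t g z' t' g' tri' dk.
  move=> /(dist_eq0 conG) e; subst g'; rewrite distxx addn0 in dk.
  have [h gh] : exists h, adj g h.
    have [h gh] : exists h, g <> h.
      have /card_gt0P[h] : 0 < #|predC1 g| by rewrite cardC1; lia.
      by rewrite !inE => /eqP hg; exists h; exact: not_eq_sym.
    by have [h' [gh' _]] := dist_step conG gh; exists h'.
  exact: (no_horizontal conT conG cfree kmin gh tri' (esym dk)).
apply: (no_grid conT conG cfree kmin _ treeT perT tri' (esym dk)).
by move=> t1 g1 z1 t1' g1' tri1 /esym; exact: IH tri1.
Qed.

Lemma free_of_no_rainbow (X : sgraph) (c : {ffun X -> 'I_3}) :
  ~~ [exists v : 3.-tuple X, is_AP v && rainbow c v] -> rainbow_free c.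
Proof.
move=> /existsPn noAP x y z xyz xy yz; apply/eqP/negPn/negP => xz.
have /negP[] := noAP [tuple x; y; z]; apply/andP; split.
  by apply/is_APP; exists (dist x y); rewrite /= xyz !eqxx.
by rewrite /rainbow /= !inE negb_or xy xz yz.
Qed.

Lemma two_colors_not_enough (X : sgraph) r :
  0 < r < 3 -> 2 <= #|X| -> ~~ forces_rainbow_AP X 3 r.
Proof.
move=> r03 X2; apply/negP => /forallP force.
have [c conto] : exists c : {ffun X -> 'I_r}, exact_coloring c.
  have /card_gt1P[x [y [_ _ xy]]] := X2.
  case: r r03 {force} => [//|[|[|//]]] _.
    exists [ffun=> ord0]; apply/forallP => i; apply/existsP; exists x.
    by rewrite ffunE (ord1 i).
  exists [ffun v => if v == x then ord0 else ord_max].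
  apply/forallP => i; apply/existsP.
  case: (eqVneq i ord0) => [->|i0].
    by exists x; rewrite ffunE eqxx.
  exists y; rewrite ffunE (eq_sym y x) (negPf xy) -val_eqE /=.
  by move: i0; rewrite -val_eqE /=; have := ltn_ord i; lia.
have /implyP/(_ conto)/existsP[v /andP[_ rain]] := force c.
have := max_card [in [seq c x | x <- v]].
by rewrite (card_uniqP rain) size_map size_tuple card_ord; lia.
Qed.

Theorem theorem3p4 (T G : sgraph) :
  is_tree T -> peripheral T 3 -> connected G -> 2 <= #|G| ->
  aw (cart_prod T G) 3 = 3.
Proof.
move=> treeT perT conG G2.
have X2 : 2 <= #|cart_prod T G|.
  rewrite card_prod; have [u _ _] := perT.
  have : 0 < #|T| by apply/card_gt0P; exists (u ord0).
  by move: #|T| #|G| G2 => m n; nia.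
rewrite /aw; case: ex_minnP => r /andP[r0 force] rmin.
apply/eqP; rewrite eqn_leq; apply/andP; split; last first.
  rewrite leqNgt; apply/negP => r3.
  have /negP[] // : ~~ forces_rainbow_AP (cart_prod T G) 3 r.
  by apply: two_colors_not_enough; rewrite ?r0.
apply: rmin; apply/forallP => c; apply/implyP => conto.
apply: contraT => /free_of_no_rainbow cfree.
have conX : connected (cart_prod T G) := cart_connected treeT.1 conG.
have [|x [z [y tri]]] := exists_rainbow_geodesic conX cfree.
  by move=> i; have /forallP/(_ i)/existsP[x /eqP] := conto; exists x.
by case: (no_rainbow_geodesic treeT perT conG G2 cfree tri).
Qed.
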